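(* Let $G_K$ be a finite group of order $K$, let $D$ be an irreducible unitary representation of $G_K$ on $\mathbb{C}^n$, and let $\rho$ be a density state on $\mathbb{C}^n$ of rank $r$. Put $\varphi(g)=\mathrm{Tr}[\rho D(g)]$ for $g\in G_K$. Let $U$ be a unitary representation of $G_K$ on a Hilbert space with a cyclic vector $\xi$ such that $\varphi(g)=(\xi,U(g)\xi)$ for all $g\in G_K$. Then $U$ is a direct sum of $r$ blocks, each one unitarily equivalent to $D$; that is, up to unitary equivalence, $U=\bigoplus_{s=1}^rD_s$ with $D_s=D$ for all $s$. Moreover, from $\rho$ one obtains a pure state cyclic for $\bigoplus_{s=1}^rD$ that represents $\varphi$: there is a unit vector $\xi\in(\mathbb{C}^n)^{\oplus r}$, cyclic for $\bigoplus_{s=1}^rD$, such that $\left(\xi,\bigoplus_{s=1}^rD(g)\,\xi\right)=\mathrm{Tr}[\rho D(g)]$ for all $g\in G_K$.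
   Context: A density state is a Hermitian, positive semidefinite operator of trace one. A vector $\xi$ in the carrier space of a representation $U$ of $G_K$ is cyclic if $\{U(g)\xi: g\in G_K\}$ spans the Hilbert space. The function $\varphi$ is of positive type (all matrices $(\varphi(h_i^{-1}h_j))_{i,j}$ are positive semidefinite), and by Naimark's theorem a pair $(U,\xi)$ as in the statement exists. *)

(* Defs.v *)
From HB Require Import structures.
From mathcomp Require Import all_boot all_order all_algebra all_fingroup.
From mathcomp Require Import mxrepresentation sesquilinear spectral.
From mathcomp Require Import complex.
From mathcomp Require Import boolp classical_sets reals topology normedtype.

Set Implicit Arguments.
Unset Strict Implicit.
Unset Printing Implicit Defensive.

Import Order.TTheory GRing.Theory Num.Theory.
Local Open Scope ring_scope.
Local Open Scope sesquilinear_scope.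

(* Inner products (x, y) are conjugate-linear in x and linear in y, so that   *)
(* (xi, A xi) is linear in the operator A.  MathComp's {dot V for conj} forms *)
(* are linear in their first argument, hence the swap in [inner].             *)
Definition inner (C : numClosedFieldType) (V : lmodType C)
  (dot : {dot V for Num.conj}) (x y : V) : C := dot y x.

Definition cdot (C : numClosedFieldType) (n : nat) (x y : 'cV[C]_n) : C :=
  (x ^t* *m y) 0 0.

(* A Hilbert space is a Banach space over R[i] with an inner product inducing *)
(* its norm.                                                                  *)
Definition hilbert_dot (R : realType) (H : completeNormedModType R[i])
  (dot : {dot H for Num.conj}) : Prop := forall x : H, dot x x = `|x| ^+ 2.

Section Representations.
Variables (C : numClosedFieldType) (gT : finGroupType) (G : {group gT}).

(* Each U g is invertible, with inverse U g^-1, so being isometric makes it   *)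
(* unitary.                                                                   *)
Definition unitary_rep (V : lmodType C) (ip : V -> V -> C)
    (U : gT -> V -> V) : Prop :=
  [/\ {in G, forall g, linear (U g)},
      forall x, U 1%g x = x,
      {in G &, forall g h, forall x, U (g * h)%g x = U g (U h x)}
    & {in G, forall g, forall x y, ip (U g x) (U g y) = ip x y}].

Definition cyclic_vector (V : lmodType C) (U : gT -> V -> V) (xi : V) : Prop :=
  forall v : V, exists c : gT -> C, v = \sum_(g in G) c g *: U g xi.

Definition unitarily_equivalent
    (V : lmodType C) (ipV : V -> V -> C) (U : gT -> V -> V)
    (W : lmodType C) (ipW : W -> W -> C) (U' : gT -> W -> W) : Prop :=
  exists T : V -> W,
    [/\ linear T, bijective T,
        forall x y, ipW (T x) (T y) = ipV x y
      & {in G, forall g, forall x, T (U g x) = U' g (T x)}].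

(* The operator of C^n (column vectors) defined by the matrix D g. *)
Definition mx_act (n : nat) (D : gT -> 'M[C]_n) (g : gT) (v : 'cV[C]_n) :
  'cV[C]_n := D g *m v.

(* The direct sum of r copies of D, as block diagonal matrices acting on      *)
(* C^(n + ... + n).                                                           *)
Definition dsum_copies (n r : nat) (D : gT -> 'M[C]_n) (g : gT) :
  'M[C]_(\sum_(s < r) n) := \mxdiag_(s < r) D g.

(* [mx_irreducible] is phrased with invariant row spaces; this is the same as *)
(* irreducibility of the action on column vectors used here.                  *)
Lemma mx_irreducible_colP (n : nat) (D : mx_representation C G n) :
  mx_irreducible D <->
  (0 < n)%N /\
  forall W : {vspace 'cV[C]_n},
    {in G, forall g, forall v, v \in W -> mx_act D g v \in W} ->
    W = 0%VS \/ W = fullv.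
Proof.
rewrite mx_irrP; split=> -[n_gt0 irrD]; split=> // W.
  move=> invW; pose M : 'M[C]_(n, \dim W) := \matrix_(i, j) (vbasis W)`_j i 0.
  have colM j : col j M = (vbasis W)`_j by apply/colP=> i; rewrite !mxE.
  have col_mul k m (A : 'M[C]_(k, n)) (B : 'M[C]_(n, m)) j :
      col j (A *m B) = A *m col j B.
    by rewrite !colE mulmxA.
  have kerP (u : 'rV[C]_n) : u *m M = 0 <-> forall v, v \in W -> u *m v = 0.
    split=> [uM v Wv|uW].
      rewrite (coord_vbasis Wv) mulmx_sumr big1 // => j _.
      by rewrite -scalemxAr -colM -col_mul uM linear0 scaler0.
    apply/matrixP=> i j; have := uW (vbasis W)`_j (vbasis_mem (mem_nth _ _)).
    rewrite size_tuple ltn_ord -colM -col_mul => /(_ isT)/matrixP/(_ i 0).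
    by rewrite !mxE.
  have [M0|kM0] := eqVneq (kermx M) 0.
    right; apply/eqP; rewrite eqEdim subvf dimvf /dim /= muln1.
    move/eqP: M0; rewrite kermx_eq0 => /eqP rM.
    by rewrite -[X in (X <= _)%N]rM; exact: rank_leq_col.
  have rowM i v : v \in W -> row i (kermx M) *m v = 0.
    by move: v; apply/(kerP (row i (kermx M))); rewrite -row_mul mulmx_ker row0.
  left; have/row_fullP[B BM] : row_full (kermx M).
    apply: irrD => //; apply/mxmoduleP=> g Gg; apply/sub_kermxP/row_matrixP=> i.
    rewrite row0 row_mul (row_mul _ (kermx M)); apply/kerP => v Wv; rewrite -mulmxA.
    exact: rowM _ _ (invW g Gg v Wv).
  apply/eqP; rewrite -subv0; apply/subvP=> v Wv; rewrite memv0; apply/eqP.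
  rewrite -[v]mul1mx -BM -mulmxA; suff -> : kermx M *m v = 0 by rewrite mulmx0.
  by apply/row_matrixP=> i; rewrite row_mul row0 rowM.
move=> modW W0; pose K : {vspace 'cV[C]_n} := lker (linfun (mulmx W)).
have KP v : (v \in K) = (W *m v == 0) by rewrite memv_ker lfunE.
have [|K0|K1] := irrD K.
- move=> g Gg v; rewrite !KP mulmxA => /eqP Wv.
  have /submxP[A ->] := mxmoduleP modW g Gg.
  by rewrite -mulmxA Wv mulmx0.
- rewrite /row_full -mxrank_tr -[_ == _]/(row_free _) -kermx_eq0; apply/eqP.
  apply/row_matrixP=> i; rewrite row0; apply: trmx_inj; rewrite trmx0.
  apply/eqP; rewrite -memv0 -K0 KP -[X in X *m _]trmxK -trmx_mul -row_mul.
  by rewrite mulmx_ker row0 trmx0.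
- case/eqP: W0; apply/matrixP=> i j.
  have : delta_mx j 0 \in K by rewrite K1 memvf.
  rewrite KP => /eqP; rewrite -colE => /matrixP /(_ i 0).
  by rewrite !mxE.
Qed.

End Representations.

(* [\is hermsymmx]: rho ^t* = rho.  Over R[i], [0 <= z] says that z is real and *)
(* nonnegative.                                                               *)
Definition density_state (C : numClosedFieldType) (n : nat) (rho : 'M[C]_n) :
    Prop :=
  [/\ rho \is hermsymmx,
      forall v : 'cV[C]_n, 0 <= cdot v (rho *m v)
    & \tr rho = 1].

(* Main.v *)
(* Factor rho = X X^* with X an n x r matrix of rank r, and let xi be the      *)
(* direct sum of the columns x_1, ..., x_r of X, so that                      *)
(* (xi, (+)_s D(g) xi) = sum_s (x_s, D(g) x_s) = Tr[rho D(g)].  Irreducible   *)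
(* matrices D(g) span the whole matrix algebra (Burnside) and the x_s are     *)
(* independent, so a combination of the D(g) can send them to arbitrary       *)
(* vectors: xi is cyclic.  Finally, a cyclic unitary representation is        *)
(* determined up to unitary equivalence by its function of positive type.     *)

Require Import Defs.
From HB Require Import structures.
From mathcomp Require Import all_boot all_order all_algebra all_fingroup.
From mathcomp Require Import mxrepresentation sesquilinear spectral.
From mathcomp Require Import complex.
From mathcomp Require Import boolp classical_sets reals topology normedtype.

Set Implicit Arguments.
Unset Strict Implicit.
Unset Printing Implicit Defensive.

Import Order.TTheory GRing.Theory Num.Theory.
Local Open Scope ring_scope.
Local Open Scope sesquilinear_scope.

(** A cyclic unitary representation is determined by its function of positive type
    ([cyclic_rep_unique]), so both claims reduce to one model: a cyclic vector of r copies of [D]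
    with function Tr[rho D(g)]. By [psd_rank_factor], rho is [X *m X^t*] with r independent columns
    in [X]; stacking them gives the vector. Its function is a trace ([cdot_dsum]), and Burnside's
    theorem makes it cyclic ([cyclic_dsum]). *)

Lemma linear_sum_scale (C : nzRingType) (V W : lmodType C) (f : V -> W)
    (I : finType) (P : {pred I}) (c : I -> C) (v : I -> V) :
  linear f -> f (\sum_(i in P) c i *: v i) = \sum_(i in P) c i *: f (v i).
Proof.
move=> lin_f; have f0 : f 0 = 0.
  by have := lin_f (-1) 0 0; rewrite scaler0 addr0 scaleN1r addNr.
by elim/big_rec2: _ => // i _ w _ <-; rewrite lin_f.
Qed.

Section InnerProducts.
Variable C : numClosedFieldType.

Definition inner_product (V : lmodType C) (ip : V -> V -> C) : Prop :=
  [/\ forall x, scalar (ip x),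
      forall x y, ip y x = (ip x y)^*
    & forall x, ip x x = 0 -> x = 0].

Lemma inner_product_dot (V : lmodType C) (dot : {dot V for Num.conj}) :
  inner_product (inner dot).
Proof.
split=> [x a y z|x y|x].
- by rewrite /inner linearDl linearZl_LR.
- by rewrite /inner hermC mul1r.
- by move/eqP; rewrite /inner dnorm_eq0 => /eqP.
Qed.

Lemma inner_product_cdot n : inner_product (@cdot C n).
Proof.
split=> [x a y z|x y|x].
- by rewrite /cdot mulmxDr -scalemxAr !mxE.
- rewrite /cdot !mxE rmorph_sum; apply: eq_bigr => i _.
  by rewrite !mxE rmorphM /= conjCK mulrC.
- rewrite /cdot !mxE => /eqP; rewrite psumr_eq0; last first.
    by move=> i _; rewrite !mxE mulrC mul_conjC_ge0.
  move/allP=> x0; apply/colP=> i; rewrite mxE; apply/eqP.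
  by have := x0 i; rewrite mem_index_enum !mxE mulrC mul_conjC_eq0; apply.
Qed.

Variables (gT : finGroupType) (G : {group gT}).

(** Unitarity moves [U g] across as [U g^-1], so the Gram matrix of the orbit depends only on the
    function of positive type. *)
Lemma gram_orbit (V : lmodType C) (ip : V -> V -> C) (U : gT -> V -> V) (xi : V)
    (a b : gT -> C) :
  inner_product ip -> unitary_rep G ip U ->
  ip (\sum_(g in G) a g *: U g xi) (\sum_(h in G) b h *: U h xi) =
  \sum_(g in G) \sum_(h in G) (a g)^* * b h * ip xi (U (g^-1 * h)%g xi).
Proof.
case=> lin_ip ipC _ [_ U1 UM Uip].
have ip_sum x (c : gT -> C) (y : gT -> V) :
    ip x (\sum_(g in G) c g *: y g) = \sum_(g in G) c g * ip x (y g).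
  exact: (@linear_sum_scale _ V C^o).
rewrite ipC ip_sum rmorph_sum; apply: eq_bigr => g Gg.
rewrite rmorphM /= -ipC ip_sum mulr_sumr; apply: eq_bigr => h Gh.
rewrite mulrA; congr (_ * _); have Gg' := groupVr Gg.
by rewrite -(Uip _ Gg') -!UM // mulVg U1.
Qed.

(* Both orbits have the same Gram matrix, so mapping a combination of the U g *)
(* xi to that of the U' g eta with equal coefficients is well defined.        *)
Lemma cyclic_rep_unique (V W : lmodType C)
    (ipV : V -> V -> C) (U : gT -> V -> V) (xi : V)
    (ipW : W -> W -> C) (U' : gT -> W -> W) (eta : W) :
  inner_product ipV -> unitary_rep G ipV U -> cyclic_vector G U xi ->
  inner_product ipW -> unitary_rep G ipW U' -> cyclic_vector G U' eta ->
  {in G, forall g, ipV xi (U g xi) = ipW eta (U' g eta)} ->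
  unitarily_equivalent G ipV U ipW U'.
Proof.
move=> ipVP UP cycU ipWP UP' cycU' phi.
pose s (c : gT -> C) := \sum_(g in G) c g *: U g xi.
pose s' (c : gT -> C) := \sum_(g in G) c g *: U' g eta.
have gram a b : ipW (s' a) (s' b) = ipV (s a) (s b).
  rewrite /s /s' !gram_orbit //; apply: eq_bigr => g Gg; apply: eq_bigr => h Gh.
  by rewrite phi // groupM ?groupV.
have lin_comb (Z : lmodType C) (T : gT -> Z) k a b :
    \sum_(g in G) (k * a g + b g) *: T g =
    k *: (\sum_(g in G) a g *: T g) + \sum_(g in G) b g *: T g.
  rewrite scaler_sumr -big_split; apply: eq_bigr => g _.
  by rewrite scalerDl scalerA.
have sD k a b : s (fun g => k * a g + b g) = k *: s a + s b.
  exact: lin_comb.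
have s'D k a b : s' (fun g => k * a g + b g) = k *: s' a + s' b.
  exact: lin_comb.
(* The group acts by left translation on coefficients, alike on both sides; hence [T] below
   intertwines. *)
have orbitJ (Z : lmodType C) (ip : Z -> Z -> C) (T : gT -> Z -> Z) z a h
    (TP : unitary_rep G ip T) : h \in G ->
    \sum_(g in G) a (h^-1 * g)%g *: T g z = T h (\sum_(g in G) a g *: T g z).
  case: TP => linT _ TM _ Gh; rewrite (linear_sum_scale _ _ _ (linT h Gh)).
  rewrite (reindex_inj (mulgI h)) /=.
  apply: eq_big => [g|g]; first by rewrite groupMl.
  by rewrite groupMl // => Gg; rewrite mulKg TM.
have sJ a h : h \in G -> s (fun g => a (h^-1 * g)%g) = U h (s a).
  exact: (orbitJ _ _ _ xi _ _ UP).
have s'J a h : h \in G -> s' (fun g => a (h^-1 * g)%g) = U' h (s' a).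
  exact: (orbitJ _ _ _ eta _ _ UP').
(* A difference vanishes iff its square norm does, and [gram] equates these norms: [T] is well
   defined and injective. *)
have ss' a b : s a = s b <-> s' a = s' b.
  have d : s (fun g => -1 * b g + a g) = s a - s b by rewrite sD scaleN1r addrC.
  have d' : s' (fun g => -1 * b g + a g) = s' a - s' b.
    by rewrite s'D scaleN1r addrC.
  have [lV _ V0] := ipVP; have [lW _ W0] := ipWP.
  have ip0 (Z : lmodType C) (ip : Z -> Z -> C) :
      (forall x, scalar (ip x)) -> ip 0 0 = 0.
    by move=> l; have := l 0 (-1) 0 0; rewrite scaler0 addr0 mulN1r addNr.
  split=> /eqP; rewrite -subr_eq0 => /eqP e; apply/eqP; rewrite -subr_eq0; apply/eqP.
    by apply: W0; rewrite -d' gram d e ip0.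
  by apply: V0; rewrite -d -gram d' e ip0.
have [c cP] := choice cycU; have [c' cP'] := choice cycU'.
have sc v : s (c v) = v by rewrite /s -cP.
have s'c w : s' (c' w) = w by rewrite /s' -cP'.
pose T v := s' (c v).
have Ts a : T (s a) = s' a by apply/ss'; rewrite sc.
exists T; split=> [k u v||u v|g Gg v].
- by rewrite -{1}(sc u) -{1}(sc v) -sD Ts s'D.
- exists (fun w => s (c' w)) => [v|w]; last by rewrite Ts.
  by rewrite -[RHS]sc; apply/ss'; rewrite s'c.
- by rewrite gram !sc.
- by rewrite -{1}(sc v) -sJ // Ts s'J.
Qed.

End InnerProducts.

Section PositiveSemidefinite.
Variable C : numClosedFieldType.

Lemma adjmxM m n p (A : 'M[C]_(m, n)) (B : 'M[C]_(n, p)) :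
  (A *m B)^t* = B^t* *m A^t*.
Proof. by rewrite trmx_mul map_mxM. Qed.

Lemma psd_factor n (M : 'M[C]_n) :
  M \is hermsymmx -> (forall v, 0 <= cdot v (M *m v)) ->
  exists Z : 'M[C]_n, M = Z *m Z^t*.
Proof.
move=> /hermitian_normalmx/orthomx_spectralP.
set P := spectralmx M; set d := spectral_diag M.
have Pu : P \is unitarymx by exact: spectral_unitarymx.
rewrite invmx_unitary // => Mdef M_ge0.
(* Each eigenvalue is the quadratic form at its unit eigenvector, a column of [P^t*]. *)
have d_ge0 i : 0 <= d 0 i.
  suff <- : cdot (col i (P^t*)) (M *m col i (P^t*)) = d 0 i by [].
  have PK : P *m P^t* = 1%:M by apply/unitarymxP.
  rewrite /cdot colE adjmxM trmxCK trmx_delta map_delta_mx Mdef -!mulmxA.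
  rewrite (mulmxA P (P^t*)) PK mul1mx (mulmxA P (P^t*)) PK mul1mx.
  by rewrite -rowE -colE !mxE eqxx.
exists (P^t* *m diag_mx (map_mx sqrtC d)).
rewrite adjmxM trmxCK tr_diag_mx map_diag_mx mulmxA -(mulmxA (P^t*)) mulmx_diag.
rewrite {1}Mdef; congr (_ *m diag_mx _ *m _); apply/rowP=> i; rewrite !mxE.
by rewrite /= conj_Creal ?ger0_real ?sqrtC_ge0 // -expr2 sqrtCK.
Qed.

(* Compressing to an orthonormal basis [Q] of the row space makes the number  *)
(* of columns equal to the rank.                                              *)
Lemma psd_rank_factor n (M : 'M[C]_n) :
  M \is hermsymmx -> (forall v, 0 <= cdot v (M *m v)) ->
  exists X : 'M[C]_(n, \rank M), M = X *m X^t*.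
Proof.
move=> Mh M_ge0; have MC : M^t* = M.
  by move: Mh; rewrite qualifE /= expr0 scale1r => /eqP <-.
have : exists2 Q : 'M_(\rank M, n), Q \is unitarymx & (M <= Q)%MS.
  exists (schmidt (row_base M)).
    by rewrite schmidt_unitarymx ?rank_leq_row.
  by apply: submx_trans (schmidt_sub _); rewrite eq_row_base.
move: (\rank M) => k [Q Qu /submxP[A Mdef]].
(* The projection [Q^t* *m Q] fixes [M] on the right, hence by self-adjointness on the left, so
   factoring the compression of [M] suffices. *)
have MQ : M *m Q^t* *m Q = M.
  by rewrite Mdef -(mulmxA A) (unitarymxP Qu) mulmx1.
have QM : Q^t* *m (Q *m M) = M by rewrite -{2}MC -{2}MQ !adjmxM trmxCK MC.
have [||Z Zdef] := @psd_factor _ (Q *m M *m Q^t*).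
- by rewrite qualifE /= expr0 scale1r !adjmxM trmxCK MC mulmxA.
- move=> v; have := M_ge0 (Q^t* *m v).
  by rewrite /cdot adjmxM trmxCK !mulmxA.
exists (Q^t* *m Z); rewrite adjmxM trmxCK mulmxA -(mulmxA (Q^t*)) -Zdef.
by rewrite -!mulmxA (mulmxA M) MQ QM.
Qed.

End PositiveSemidefinite.

Section DirectSum.
Variables (C : numClosedFieldType) (gT : finGroupType) (G : {group gT}).
Variables (n : nat) (D : mx_representation C G n).

Lemma cdot_mxcol r (x y : 'I_r -> 'cV[C]_n) :
  cdot (\mxcol_s x s) (\mxcol_s y s) = \sum_s cdot (x s) (y s).
Proof.
rewrite /cdot tr_mxcol.
have -> : (\mxrow_s (x s)^T) ^ Num.conj = \mxrow_s (x s)^t*.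
  by apply/matrixP=> i j; rewrite !mxE.
by rewrite mul_mxrow_mxcol summxE.
Qed.

Lemma mx_act_dsum r g (x : 'I_r -> 'cV[C]_n) :
  mx_act (dsum_copies r D) g (\mxcol_s x s) = \mxcol_s (D g *m x s).
Proof. exact: mul_mxdiag_mxcol. Qed.

Lemma unitary_rep_dsum r :
  {in G, forall g, D g \is unitarymx} ->
  unitary_rep G (@cdot C _) (mx_act (dsum_copies r D)).
Proof.
move=> Du; split=> [g Gg a u v|x|g h Gg Gh x|g Gg x y].
- by rewrite /mx_act mulmxDr scalemxAr.
- rewrite -[x]submxcolK mx_act_dsum; apply: eq_mxcol => s.
  by rewrite repr_mx1 mul1mx.
- rewrite -[x]submxcolK !mx_act_dsum; apply: eq_mxcol => s.
  by rewrite repr_mxM // mulmxA.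
- rewrite -[x]submxcolK -[y]submxcolK !mx_act_dsum !cdot_mxcol.
  apply: eq_bigr => s _; rewrite /cdot adjmxM -mulmxA (mulmxA _ (D g)).
  have := Du g Gg; rewrite -trmxC_unitary => /unitarymxP; rewrite trmxCK => ->.
  by rewrite mul1mx.
Qed.

Lemma cyclic_dsum r (X : 'M[C]_(n, r)) :
  mx_irreducible D -> \rank X = r ->
  cyclic_vector G (mx_act (dsum_copies r D)) (\mxcol_(s < r) col s X).
Proof.
move=> irrD rkX v.
(* Burnside: every matrix [A] is the combination of the [D g] with coefficients [a g A]. *)
have /mx_abs_irrP[_ [a aP]] : mx_absolutely_irreducible D.
  exact: group_closure_closed_field.
have /row_fullP[Y YX] : row_full X by rewrite /row_full rkX.
(* As [Y] is a left inverse of [X], this [A] sends column s of [X] to block s of [v]. *)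
pose A := (\matrix_(i, s) submxcol v s i 0) *m Y.
exists (a^~ A).
transitivity (\mxcol_(s < r) (A *m col s X)).
  rewrite -[LHS]submxcolK; apply: eq_mxcol => s.
  rewrite /A colE -!mulmxA (mulmxA Y) YX mul1mx -colE.
  by apply/colP=> i; rewrite !mxE.
rewrite [RHS](eq_bigr (fun g => \mxcol_s (a g A *: D g *m col s X))); last first.
  move=> g _; rewrite mx_act_dsum; apply/colP=> k.
  by rewrite !(mxE, =^~ scalemxAl).
rewrite -mxcol_sum; apply: eq_mxcol => s.
by rewrite {1}[A]aP mulmx_suml; under eq_bigr do rewrite -scalemxAl.
Qed.

(** By cyclicity the trace is that of [X^t* *m D g *m X], whose diagonal entries are the blockwise
    inner products. *)
Lemma cdot_dsum r (X : 'M[C]_(n, r)) g :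
  let xi := \mxcol_(s < r) col s X in
  cdot xi (mx_act (dsum_copies r D) g xi) = \tr (X *m X^t* *m D g).
Proof.
rewrite /= mx_act_dsum cdot_mxcol -mulmxA mxtrace_mulC.
apply: eq_bigr => s _; rewrite /cdot mulmxA !mxE.
apply: eq_bigr => i _; rewrite !mxE; congr (_ * _).
by apply: eq_bigr => j _; rewrite !mxE.
Qed.

End DirectSum.

Theorem proposition3 (R : realType) (K : nat) (gT : finGroupType)
    (G : {group gT}) (hK : #|G| = K)
    (n : nat) (D : mx_representation R[i] G n)
    (hDunitary : {in G, forall g, D g \is unitarymx})
    (hDirr : mx_irreducible D)
    (rho : 'M[R[i]]_n) (hrho : density_state rho)
    (r : nat) (hr : \rank rho = r) :
  (forall (H : completeNormedModType R[i]) (dot : {dot H for Num.conj})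
          (U : gT -> H -> H) (xi : H),
      hilbert_dot dot ->
      unitary_rep G (inner dot) U ->
      cyclic_vector G U xi ->
      {in G, forall g, \tr (rho *m D g) = inner dot xi (U g xi)} ->
      unitarily_equivalent G (inner dot) U
        (@cdot R[i] (\sum_(s < r) n)) (mx_act (dsum_copies r D)))
  /\
  (exists xi : 'cV[R[i]]_(\sum_(s < r) n),
      [/\ cdot xi xi = 1,
          cyclic_vector G (mx_act (dsum_copies r D)) xi
        & {in G, forall g,
             cdot xi (mx_act (dsum_copies r D) g xi) = \tr (rho *m D g)}]).
Proof.
case: hrho => rho_herm rho_ge0 tr_rho.
have [X rhoX] := psd_rank_factor rho_herm rho_ge0; rewrite hr in X rhoX.
have rkX : \rank X = r.
  apply/eqP; rewrite eqn_leq rank_leq_col -{1}hr {1}rhoX.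
  exact: mxrankM_maxl.
have cycX := cyclic_dsum hDirr rkX; have unitU := unitary_rep_dsum r hDunitary.
have phiX g := cdot_dsum D X g; rewrite -rhoX in phiX.
split=> [H dot U xi _ unitV cycV phiV|].
  apply: (cyclic_rep_unique (inner_product_dot dot) unitV cycV
           (@inner_product_cdot _ _) unitU cycX) => g Gg.
  by rewrite phiX phiV.
exists (\mxcol_(s < r) col s X); split=> //.
(* The square norm is the function at the identity, the trace of rho. *)
by have [_ U1 _ _] := unitU; rewrite -{2}[\mxcol_s _]U1 phiX repr_mx1 mulmx1.
Qed.
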